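(* Let $T_1,T_2\in\mathcal{B}(\mathcal{H})$ be any contractions and let $Q\in\mathcal{B}(\mathcal{H})$ be such that $QT_1$ is a contraction and $T_1T_2=T_2QT_1$. Then there are a Hilbert space $\mathcal{K}$ containing $\mathcal{H}$, isometric lifts $V_1,V_2\in\mathcal{B}(\mathcal{K})$ of $T_1,T_2$ respectively, a lift $\overline{Q}\in\mathcal{B}(\mathcal{K})$ of $Q$, and a bounded operator $V_{1Q}\in\mathcal{B}(\mathcal{K})$ such that $\overline{Q}V_{1Q}$ is an isometric lift of $QT_1$ and $V_1V_2=V_2\overline{Q}V_{1Q}$.
   Context: All Hilbert spaces are complex; $\mathcal{B}(\mathcal{H})$ is the algebra of bounded linear operators on $\mathcal{H}$; containment of Hilbert spaces means containment as a closed linear subspace; a contraction is an operator of norm at most one. An operator $B\in\mathcal{B}(\mathcal{K})$ is a lift of $A\in\mathcal{B}(\mathcal{H})$, $\mathcal{H}\subseteq\mathcal{K}$, if $\mathcal{H}$ is invariant under $B^*$ and $B^*|_{\mathcal{H}}=A^*$; it is an isometric lift if in addition $B$ is an isometry. *)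

(* Defs.v *)
From HB Require Import structures.
From mathcomp Require Import all_boot all_order all_algebra.
From mathcomp Require Import all_classical all_reals all_analysis.
From mathcomp Require Export complex.

Set Implicit Arguments.
Unset Strict Implicit.
Unset Printing Implicit Defensive.

Import Order.TTheory GRing.Theory Num.Theory.
Import numFieldNormedType.Exports.

Local Open Scope classical_set_scope.
Local Open Scope complex_scope.
Local Open Scope ring_scope.

(* The inner product is linear in its first argument and conjugate-linear in
   the second one, as for every form of type {dot _ for _}. *)
HB.mixin Record CompleteNormedModule_isHilbert (R : realType) H
    & CompleteNormedModule R[i] H := {
  hdot : {dot H for (@Num.conj R[i])};
  hdot_norm : forall x : H, `|x| ^+ 2 = hdot x x
}.

#[short(type="hilbertType")]
HB.structure Definition Hilbert (R : realType) :=
  {H of CompleteNormedModule R[i] H & CompleteNormedModule_isHilbert R H}.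

Notation "''[' u , v ]" := (hdot u v) : ring_scope.

HB.mixin Record isBoundedOp (K : numFieldType) (U V : normedModType K)
    (f : U -> V) := {
  op_bounded : bounded_near f (nbhs (0 : U))
}.

#[short(type="boundedOp")]
HB.structure Definition BoundedOp (K : numFieldType) (U V : normedModType K) :=
  {f of @GRing.Linear K U V *:%R f & isBoundedOp K U V f}.

Notation "''B' ( H )" := (boundedOp H H) (format "''B' ( H )") : type_scope.

Section CompBounded.
Context (K : numFieldType) (U V W : normedModType K).
Context (f : boundedOp V W) (g : boundedOp U V).

Lemma comp_op_bounded : bounded_near (f \o g) (nbhs (0 : U)).
Proof.
apply/linear_bounded_continuous => x; apply: continuous_comp.
  by apply: (linear_bounded_continuous g).1; exact: op_bounded.
by apply: (linear_bounded_continuous f).1; exact: op_bounded.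
Qed.

HB.instance Definition _ := isBoundedOp.Build K U W (f \o g) comp_op_bounded.

End CompBounded.

Section OperatorNorm.
Context (R : realType) (U V : normedModType R[i]).

(* Norms over R[i] are valued in R[i]; their real part recovers the number. *)
Definition opnorm (f : boundedOp U V) : R :=
  sup [set complex.Re `|f x| | x in [set x : U | `|x| <= 1]].

Definition contractive (f : boundedOp U V) := opnorm f <= 1.

Definition isometric (f : boundedOp U V) := forall x, `|f x| = `|x|.

Lemma contractiveP (f : boundedOp U V) :
  contractive f <-> forall x, `|f x| <= `|x|.
Proof.
have ReE (W : normedModType R[i]) (y : W) : (complex.Re `|y|)%:C = `|y|.
  by apply: RRe_real; rewrite realE normr_ge0.
have leRe (y : V) (r : R) : (complex.Re `|y| <= r) = (`|y| <= r%:C).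
  by rewrite -(ReE _ y) lecR.
rewrite /contractive /opnorm; set S := image _ _; split=> [supS x|fle]; last first.
  apply: ge_sup; first by exists (complex.Re `|f 0|), 0 => //=; rewrite normr0.
  by move=> _ [z /= z1 <-]; rewrite leRe; exact: le_trans (fle z) z1.
have hS : has_sup S.
  split; first by exists (complex.Re `|f 0|), 0 => //=; rewrite normr0.
  have /bounded_funP/(_ 1)[M fM] := op_bounded (s := f).
  have M0 : 0 <= M by apply: le_trans (fM 0 _); rewrite ?normr0.
  exists (complex.Re M) => _ [z /= z1 <-].
  by rewrite leRe (RRe_real (ger0_real M0)) fM.
have [->|x0] := eqVneq x 0; first by rewrite linear0 !normr0.
have nx0 : 0 < `|x| by rewrite normr_gt0.
pose y := `|x|^-1 *: x.
have y1 : `|y| <= 1 by rewrite normrZ normfV normr_id mulVf ?gt_eqF.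
have : complex.Re `|f y| <= 1.
  by apply: le_trans supS; apply: ub_le_sup; [exact: hS.2|exists y].
rewrite leRe /y linearZ/= normrZ normfV normr_id.
by rewrite mulrC ler_pdivrMr// mul1r.
Qed.

End OperatorNorm.

Section Lifts.
Context (R : realType).

Definition is_adjoint (H : hilbertType R) (A A' : 'B(H)) :=
  forall x y, '[A x, y] = '[x, A' y].

Lemma is_adjoint_unique (H : hilbertType R) (A B C : 'B(H)) :
  is_adjoint A B -> is_adjoint A C -> B =1 C.
Proof.
move=> AB AC y; apply/eqP; rewrite -subr_eq0 -normr_eq0 -sqrf_eq0 hdot_norm.
by rewrite linearB/= -AB -AC subrr.
Qed.

(* J exhibits H as a closed linear subspace of the Hilbert space K. *)
Definition hilbert_inclusion (H K : hilbertType R) (J : {linear H -> K}) :=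
  (forall x y, '[J x, J y] = '[x, y]) /\ closed (range J).

(* For h in H the vector B^* h is again in H and is equal to A^* h. *)
Definition is_lift (H K : hilbertType R) (J : {linear H -> K})
    (A : 'B(H)) (B : 'B(K)) :=
  exists (A' : 'B(H)) (B' : 'B(K)),
    [/\ is_adjoint A A', is_adjoint B B' & forall h, B' (J h) = J (A' h)].

Definition is_isometric_lift (H K : hilbertType R) (J : {linear H -> K})
    (A : 'B(H)) (B : 'B(K)) :=
  is_lift J A B /\ isometric B.

End Lifts.

(* Main.v *)
Require Import Defs.
From HB Require Import structures.
From mathcomp Require Import all_boot all_order all_algebra.
From mathcomp Require Import all_classical all_reals all_analysis.
From mathcomp Require Import ring lra zify.

Set Implicit Arguments.
Unset Strict Implicit.
Unset Printing Implicit Defensive.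

Import Order.TTheory GRing.Theory Num.Theory.
Import numFieldNormedType.Exports.

Local Open Scope classical_set_scope.
Local Open Scope complex_scope.
Local Open Scope ring_scope.

(** Write [T1' := Q \o T1], so that the hypothesis reads [T1 T2 = T2 T1'] for
    three contractions.

    The operator [Q] enters only at the very end.  Suppose that [T1], [T2] and
    [T1'] have isometric lifts [V1], [V2] and [V1'] on one space [K] with
    [V1 V2 = V2 V1'], and let [p] be the adjoint of the inclusion [J].  Let
    [Qbar] be [Q] on [H] and the identity on the orthogonal complement of [H],
    and let [V1Q] be [V1'] with its [H]-component [Q T1 p x] replaced by
    [T1 p x].  Then [Qbar V1Q = V1'], and since [V1Q] need not be a lift of
    anything, this solves the problem.

    The three isometries come from an Ando-type construction on the space [K]
    of square-summable sequences in [H], with [H] placed at index 0.  A defect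
    map [D], with [|D h|^2 = |h|^2 - |T h|^2], gives the isometric lift
    [W x = J T p x + e D p x + s (x - J p x)] of [T], where [s] doubles indices
    and [e] inserts at odd indices.  Let [W1], [W2], [W1'] be the lifts of
    [T1], [T2], [T1'].  The products [W1 W2] and [W2 W1'] differ only by the
    vectors [X h] and [Y h] that they insert in the places left free by [s^2].
    These have equal norms; as [W2] inserts in another residue class modulo 4
    than [W1] and [W1'], the ranges of [X] and [Y] are moreover orthogonal.
    Hence the reflection [U] in the orthogonal complement of all the vectors
    [s^(2 n) (X h - Y h)] carries [X h] to [Y h]; it also fixes [H] and
    commutes with [s^2], so [U W1 W2 = W2 W1' U] (isometric_intertwining).  The
    required isometries are [V1 = U W1], [V2 = W2 U] and [V1' = U W1'], because
    [V1 V2 = U W1 W2 U = W2 W1' U U = W2 W1' = V2 V1'].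

    The supporting facts are the projection theorem (projection_ex), the Riesz
    representation and its corollary on adjoints (riesz, adjoint_ex), and the
    defect maps (defect_ex), which are built without operator square roots. *)

(** * Preliminaries on complex scalars and linear maps *)

Section ComplexScalars.
Context (R : realType).
Implicit Types a b : R[i].

Lemma ReD a b : complex.Re (a + b) = complex.Re a + complex.Re b.
Proof. by case: a; case: b. Qed.

Lemma ReB a b : complex.Re (a - b) = complex.Re a - complex.Re b.
Proof. by case: a; case: b. Qed.

Lemma conjcM a b : (a * b)^*%C = a^*%C * b^*%C.
Proof. exact: rmorphM. Qed.

Lemma gtc0_realE a : 0 < a -> a = (complex.Re a)%:C.
Proof. by move=> a0; rewrite RRe_real// gtr0_real. Qed.

(** The squared modulus as an element of [R]: all estimates below are carried
    out in the totally ordered field [R] instead of [R[i]]. *)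
Definition normsq a : R := complex.Re a ^+ 2 + complex.Im a ^+ 2.

Lemma normsq_ge0 a : 0 <= normsq a.
Proof. by rewrite addr_ge0 ?sqr_ge0. Qed.

Lemma normsq_eq0 a : normsq a = 0 -> a = 0.
Proof.
case: a => a b; rewrite /normsq/= => /eqP.
by rewrite paddr_eq0 ?sqr_ge0// !sqrf_eq0 => /andP[/eqP-> /eqP->].
Qed.

Lemma quadratic_ge0_discr (s c e : R) : 0 <= s ->
  (forall t : R, 0 <= t ^+ 2 * s - t * c *+ 2 + e) -> c ^+ 2 <= e * s.
Proof.
move=> s0 st; have [s00|sn0] := eqVneq s 0.
  have [->|c0] := eqVneq c 0; first by rewrite expr0n s00 mulr0.
  have := st ((e + 1) / c / 2); rewrite s00 mulr0 add0r.
  have -> : (e + 1) / c / 2 * c *+ 2 = e + 1 by field.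
  lra.
have sp : 0 < s by rewrite lt_neqAle eq_sym sn0.
have := st (c / s).
have -> : (c / s) ^+ 2 * s - c / s * c *+ 2 + e = e - c ^+ 2 / s by field.
by rewrite subr_ge0 ler_pdivrMr.
Qed.

End ComplexScalars.

Section MakeLinear.
Context (S : pzRingType) (U V : lmodType S).

Definition mk_linear (f : U -> V) (flin : linear f) : {linear U -> V} :=
  HB.pack f (GRing.isLinear.Build S U V *:%R f flin).

Lemma linear_sub (f g : {linear U -> V}) : linear (fun x => f x - g x).
Proof.
by move=> a x y; rewrite (linearP f) (linearP g) scalerBr opprD addrACA.
Qed.

End MakeLinear.

(** * Inner products and their squared norms *)

(** Inner products on arbitrary modules are considered, because the space of
    sequences has one before it is normed. *)
Section DotBasics.
Context (R : realType) (U : lmodType R[i]) {f : {dot U for @Num.conj R[i]}}.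
Implicit Types (x y z : U) (a : R[i]).
Local Notation "''[' u , v ]" := (f u v) : ring_scope.

Definition dsqn x : R := complex.Re '[x, x].
Local Notation sqn := dsqn.

Lemma dotC x y : '[x, y] = ('[y, x])^*%C.
Proof. by rewrite hermC /= expr0 mul1r. Qed.

Lemma dotDl x y z : '[x + y, z] = '[x, z] + '[y, z].
Proof. exact: linearDl. Qed.
Lemma dotDr x y z : '[x, y + z] = '[x, y] + '[x, z].
Proof. exact: linearDr. Qed.
Lemma dotBl x y z : '[x - y, z] = '[x, z] - '[y, z].
Proof. exact: linearBl. Qed.
Lemma dotBr x y z : '[x, y - z] = '[x, y] - '[x, z].
Proof. exact: linearBr. Qed.
Lemma dotZl a x y : '[a *: x, y] = a * '[x, y].
Proof. exact: linearZl_LR. Qed.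
Lemma dotZr a x y : '[x, a *: y] = a^*%C * '[x, y].
Proof. exact: linearZr_LR. Qed.
Lemma dotNl x y : '[- x, y] = - '[x, y].
Proof. exact: linearNl. Qed.
Lemma dot0l x : '[0, x] = 0.
Proof. exact: linear0l. Qed.
Lemma dot0r x : '[x, 0] = 0.
Proof. exact: linear0r. Qed.

Lemma dotxx x : '[x, x] = (sqn x)%:C.
Proof. by rewrite RRe_real// ger0_real// dnorm_ge0. Qed.

Lemma sqn_ge0 x : 0 <= sqn x.
Proof. by rewrite -lecR -dotxx dnorm_ge0. Qed.

Lemma sqn_eq0 x : sqn x = 0 -> x = 0.
Proof. by move=> x0; apply/eqP; rewrite -(dnorm_eq0 f) dotxx x0. Qed.

Lemma sqnN x : sqn (- x) = sqn x.
Proof. by rewrite /sqn linearNl linearNr opprK. Qed.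

Lemma sqn0 : sqn 0 = 0.
Proof. by rewrite /sqn dot0l. Qed.

Lemma dotReC x y : complex.Re '[y, x] = complex.Re '[x, y].
Proof. by rewrite (dotC x); case: '[y, x]. Qed.

Lemma dotImC x y : complex.Im '[y, x] = - complex.Im '[x, y].
Proof. by rewrite (dotC x); case: '[y, x] => a b /=; rewrite opprK. Qed.

Lemma sqnD x y : sqn (x + y) = sqn x + sqn y + complex.Re '[x, y] *+ 2.
Proof. rewrite /sqn dotDl !dotDr !ReD (dotReC x y); ring. Qed.

Lemma sqnB x y : sqn (x - y) = sqn x + sqn y - complex.Re '[x, y] *+ 2.
Proof. by rewrite sqnD sqnN linearNr raddfN/= mulNrn. Qed.

Lemma sqnZ a x :
  sqn (a *: x) = normsq a * sqn x.
Proof.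
by rewrite /sqn /normsq dotZl dotZr dotxx; case: a => a b /=; ring.
Qed.

Lemma dotIm x y : complex.Im '[x, y] = complex.Re '[x, 'i *: y].
Proof. by rewrite dotZr; case: '[x, y] => a b /=; ring. Qed.

(** The real part suffices; applied to [y] and ['i *: y] it also bounds the
    modulus of the inner product. *)
Lemma CauchySchwarz_Re x y : complex.Re '[x, y] ^+ 2 <= sqn x * sqn y.
Proof.
apply: quadratic_ge0_discr => [|t]; first exact: sqn_ge0.
have := sqn_ge0 (x - t%:C *: y).
rewrite sqnB sqnZ /normsq dotZr conjc_real /= expr0n addr0.
have -> : complex.Re (t%:C * '[x, y]) = t * complex.Re '[x, y].
  by case: '[x, y] => a b /=; ring.
lra.
Qed.

Lemma sqnD_le x y : sqn (x + y) <= (sqn x + sqn y) *+ 2.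
Proof. have := sqn_ge0 (x - y); rewrite sqnB sqnD; lra. Qed.

Lemma sqrt_sqnD x y :
  Num.sqrt (sqn (x + y)) <= Num.sqrt (sqn x) + Num.sqrt (sqn y).
Proof.
rewrite -(ler_pXn2r (n := 2))// ?nnegrE ?addr_ge0 ?sqrtr_ge0//.
rewrite sqrrD !sqr_sqrtr ?sqn_ge0// sqnD [leRHS]addrAC lerD2l lerMn2r/=.
apply: le_trans (ler_norm _) _; rewrite -sqrtr_sqr -sqrtrM ?sqn_ge0//.
by rewrite ler_sqrt ?mulr_ge0 ?sqn_ge0// CauchySchwarz_Re.
Qed.

Lemma sqrt_sqnZ a x :
  (Num.sqrt (sqn (a *: x)))%:C = `|a| * (Num.sqrt (sqn x))%:C.
Proof.
by rewrite sqnZ normc_def -rmorphM sqrtrM ?normsq_ge0.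
Qed.

End DotBasics.

Arguments dsqn {R U} f x.
Notation sqn := (dsqn hdot).

Lemma hnormE (R : realType) (H : hilbertType R) (x : H) :
  `|x| = (Num.sqrt (sqn x))%:C.
Proof.
apply/eqP; rewrite -(eqrXn2 (n := 2))// ?lecR ?sqrtr_ge0// hdot_norm dotxx.
by rewrite -rmorphXn/= sqr_sqrtr ?sqn_ge0.
Qed.

Lemma le_norm_sqn (R : realType) (H K : hilbertType R)
    (x : H) (y : K) (c : R) : 0 <= c ->
  (`|x| <= c%:C * `|y|) = (sqn x <= c ^+ 2 * sqn y).
Proof.
move=> c0; rewrite !hnormE -rmorphM lecR.
rewrite -[c in LHS](ger0_norm c0) -sqrtr_sqr -sqrtrM ?sqr_ge0//.
by rewrite ler_sqrt// mulr_ge0 ?sqr_ge0 ?sqn_ge0.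
Qed.

Lemma eq_norm_sqn (R : realType) (H K : hilbertType R) (x : H) (y : K) :
  sqn x = sqn y -> `|x| = `|y|.
Proof. by rewrite !hnormE => ->. Qed.

Lemma hdot_extl (R : realType) (H : hilbertType R) (x y : H) :
  (forall z, '[x, z] = '[y, z]) -> x = y.
Proof.
move=> xy; apply/eqP; rewrite -subr_eq0; apply/eqP/(sqn_eq0 (f := hdot)).
by rewrite /dsqn dotBl xy subrr.
Qed.

Lemma hdot_eq0C (R : realType) (H : hilbertType R) (x y : H) :
  '[x, y] = 0 -> '[y, x] = 0.
Proof. by move=> xy; rewrite dotC xy rmorph0. Qed.

Lemma sqnDo (R : realType) (H : hilbertType R) (x y : H) :
  '[x, y] = 0 -> sqn (x + y) = sqn x + sqn y.
Proof. by move=> xy; rewrite sqnD xy mul0rn addr0. Qed.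

Lemma sqnBo (R : realType) (H : hilbertType R) (x y : H) :
  '[x, y] = 0 -> sqn (x - y) = sqn x + sqn y.
Proof. by move=> xy; rewrite sqnB xy mul0rn subr0. Qed.

(** * The Hilbert space of square-summable sequences *)

Section SquareSummable.
Context (R : realType) (H : hilbertType R).
Implicit Types x y : nat -> H.

Definition l2_pred : pred (nat -> H) :=
  fun x => `[< exists M : R, forall n, \sum_(k < n) sqn (x k) <= M >].

Lemma l2_submod_closed : submod_closed l2_pred.
Proof.
split.
  by apply/asboolP; exists 0 => n; rewrite big1// => k _; exact: sqn0.
move=> a x y /asboolP[M xM] /asboolP[N yN].
apply/asboolP; exists ((normsq a * M + N) *+ 2) => n.
apply: (@le_trans _ _ (\sum_(k < n) (sqn (a *: x k) + sqn (y k)) *+ 2)).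
  by apply: ler_sum => k _; exact: sqnD_le.
rewrite sumrMnl lerMn2r/= big_split/=; apply: lerD; last exact: yN.
under eq_bigr do rewrite sqnZ.
rewrite -mulr_sumr; apply: ler_wpM2l; first exact: normsq_ge0.
exact: xM.
Qed.

HB.instance Definition _ :=
  GRing.isSubmodClosed.Build _ _ l2_pred l2_submod_closed.

Record l2 := L2 { l2_val :> nat -> H; l2_valP : l2_val \in l2_pred }.

HB.instance Definition _ := [isSub for l2_val].
HB.instance Definition _ := [Choice of l2 by <:].
HB.instance Definition _ := [SubChoice_isSubLmodule of l2 by <:].

End SquareSummable.

Section L2val.
Context (R : realType) (H : hilbertType R).
Implicit Types x y : l2 H.

Lemma l2_valD x y k : l2_val (x + y) k = l2_val x k + l2_val y k.
Proof. by []. Qed.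

Lemma l2_valZ a x k : l2_val (a *: x) k = a *: l2_val x k.
Proof. by []. Qed.

End L2val.

Section L2dot.
Context (R : realType) (H : hilbertType R).
Implicit Types x y z : l2 H.

Lemma is_cvg_sum_sqn x : cvgn (series (fun k => sqn (l2_val x k))).
Proof.
have /asboolP[M xM] := l2_valP x.
apply: nondecreasing_is_cvgn.
  by apply/nondecreasing_seqP => n; rewrite seriesSr lerDl sqn_ge0.
by exists M => _ [n _ <-]; rewrite /series/= big_mkord.
Qed.

Lemma cvg_series_comb (u v w : R^nat) (a b lu lv lw : R) :
  series u @ \oo --> lu -> series v @ \oo --> lv -> series w @ \oo --> lw ->
  series (fun k => a * u k + b * v k + w k) @ \oo --> a * lu + b * lv + lw.
Proof.
move=> hu hv hw.
have -> : series (fun k => a * u k + b * v k + w k) =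
    (fun n => a * series u n + b * series v n + series w n).
  by apply/funext => n; rewrite /series/= !big_split/= !mulr_sumr.
apply: cvgD => //; apply: cvgD; exact: cvgMr.
Qed.

Lemma is_cvg_dotRe x y :
  cvgn (series (fun k => complex.Re '[l2_val x k, l2_val y k])).
Proof.
rewrite (_ : (fun k => _) =
  fun k => 4^-1 * sqn (l2_val (x + y) k) +
           (- 4^-1) * sqn (l2_val (x - y) k) + 0).
  apply: cvgP.
  apply: cvg_series_comb; [exact: is_cvg_sum_sqn|exact: is_cvg_sum_sqn|].
  rewrite (_ : series _ = fun=> 0); first exact: cvg_cst.
  by apply/funext => n; rewrite /series/= big1.
apply/funext => k; rewrite l2_valD (sqnB (l2_val x k)) sqnD; lra.
Qed.

Lemma is_cvg_dotIm x y :
  cvgn (series (fun k => complex.Im '[l2_val x k, l2_val y k])).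
Proof.
rewrite (_ : (fun k => _) =
  fun k => complex.Re '[l2_val x k, l2_val ('i *: y) k]).
  exact: is_cvg_dotRe.
by apply/funext => k; rewrite dotIm.
Qed.

Arguments is_cvg_dotRe : clear implicits.
Arguments is_cvg_dotIm : clear implicits.

(** The inner product is defined by its real and imaginary parts, two convergent
    real series; convergence follows from that of the squared norms by
    polarization. *)
Definition l2_dot x y : R[i] :=
  limn (series (fun k => complex.Re '[l2_val x k, l2_val y k])) +i*
  limn (series (fun k => complex.Im '[l2_val x k, l2_val y k])).

Lemma l2_dotC x y : l2_dot x y = (l2_dot y x)^*%C.
Proof.
rewrite /l2_dot /=; congr Complex.
  by congr (limn (series _)); apply/funext => k; rewrite dotReC.
rewrite -limN; last exact: is_cvg_dotIm.
congr (limn _); apply/funext => n; rewrite fctE /series/= -sumrN.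
by apply: eq_bigr => k _; rewrite -dotImC.
Qed.

Lemma l2_dot_linear y : GRing.linear_for *%R (l2_dot^~ y).
Proof.
move=> a x z.
have reE := cvg_series_comb (a := complex.Re a) (b := - complex.Im a)
  (is_cvg_dotRe x y) (is_cvg_dotIm x y) (is_cvg_dotRe z y).
have imE := cvg_series_comb (a := complex.Re a) (b := complex.Im a)
  (is_cvg_dotIm x y) (is_cvg_dotRe x y) (is_cvg_dotIm z y).
rewrite /l2_dot; apply/eqP; rewrite eq_complex; apply/andP; split; apply/eqP.
  transitivity (limn (series (fun k =>
      complex.Re a * complex.Re '[l2_val x k, l2_val y k] +
      - complex.Im a * complex.Im '[l2_val x k, l2_val y k] +
      complex.Re '[l2_val z k, l2_val y k]))).
    congr (limn (series _)); apply/funext => k.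
    rewrite l2_valD l2_valZ dotDl dotZl.
    case: '[l2_val x k, l2_val y k] => ? ?.
    case: '[l2_val z k, l2_val y k] => ? ?.
    by case: a {reE imE} => ? ? /=; ring.
  rewrite (cvg_lim _ reE)//; case: a {reE imE} => ? ? /=; ring.
transitivity (limn (series (fun k =>
    complex.Re a * complex.Im '[l2_val x k, l2_val y k] +
    complex.Im a * complex.Re '[l2_val x k, l2_val y k] +
    complex.Im '[l2_val z k, l2_val y k]))).
  congr (limn (series _)); apply/funext => k.
  rewrite l2_valD l2_valZ dotDl dotZl.
  case: '[l2_val x k, l2_val y k] => ? ?.
  case: '[l2_val z k, l2_val y k] => ? ?.
  by case: a {reE imE} => ? ? /=; ring.
rewrite (cvg_lim _ imE)//; case: a {reE imE} => ? ? /=; ring.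
Qed.

Lemma l2_dot_bilinear : bilinear_for *%R (Num.conj \; *%R) l2_dot.
Proof.
split=> [y|x]; first exact: l2_dot_linear.
move=> a y z; rewrite l2_dotC l2_dot_linear rmorphD rmorphM/=.
by rewrite (l2_dotC x y) (l2_dotC x z).
Qed.

HB.instance Definition _ :=
  bilinear_isBilinear.Build _ _ _ _ _ _ _ l2_dot_bilinear.

Lemma l2_dot_herm x y : l2_dot x y = (-1) ^+ false * Num.conj (l2_dot y x).
Proof. by rewrite expr0 mul1r l2_dotC. Qed.

HB.instance Definition _ :=
  isHermitianSesquilinear.Build _ _ _ _ _ l2_dot_herm.

End L2dot.

Section L2Hilbert.
Context (R : realType) (H : hilbertType R).
Implicit Types x y z : l2 H.

Lemma l2_dot_gt0 x : x != 0 -> 0 < l2_dot x x.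
Proof.
move=> x0.
have [k xk] : exists k, l2_val x k != 0.
  apply: contrapT => /forallNP x_0; move/eqP: x0; apply.
  apply/val_inj/funext => k /=.
  by apply/eqP/negPn/negP; exact: x_0.
have im0 : limn (series (fun k => complex.Im '[l2_val x k, l2_val x k])) = 0.
  rewrite (_ : series _ = fun=> 0) ?lim_cst//.
  by apply/funext => n; rewrite /series/= big1// => i _; rewrite dotxx.
rewrite ltcE /l2_dot im0 eqxx /=.
have xk0 : 0 < sqn (l2_val x k).
  rewrite lt_neqAle sqn_ge0 andbT eq_sym; apply: contra_neq xk; exact: sqn_eq0.
apply: lt_le_trans xk0 _.
apply: (@le_trans _ _ (series (fun k => sqn (l2_val x k)) k.+1)).
  by rewrite seriesSr lerDr /series/= sumr_ge0// => i _; exact: sqn_ge0.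
apply: nondecreasing_cvgn_le; last exact: is_cvg_sum_sqn.
by apply/nondecreasing_seqP => n; rewrite seriesSr lerDl sqn_ge0.
Qed.

HB.instance Definition _ := isDotProduct.Build _ _ (@l2_dot R H) l2_dot_gt0.

Definition l2_norm x : R[i] := (Num.sqrt (dsqn (@l2_dot R H) x))%:C.

Lemma l2_normD x y : l2_norm (x + y) <= l2_norm x + l2_norm y.
Proof. by rewrite /l2_norm -rmorphD lecR sqrt_sqnD. Qed.

Lemma l2_normZ (a : R[i]) x : l2_norm (a *: x) = `|a| * l2_norm x.
Proof. exact: sqrt_sqnZ. Qed.

Lemma l2_norm0_eq0 x : l2_norm x = 0 -> x = 0.
Proof.
move/eqP; rewrite /l2_norm eq_complex/= eqxx andbT sqrtr_eq0 => x0.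
apply: (@sqn_eq0 _ _ (@l2_dot R H)); apply/eqP; rewrite eq_le x0.
exact: sqn_ge0.
Qed.

HB.instance Definition _ := @Lmodule_isNormed.Build R[i] (l2 H) l2_norm
  l2_normD l2_normZ l2_norm0_eq0.

End L2Hilbert.

Section L2Complete.
Context (R : realType) (H : hilbertType R).
Implicit Types x y z : l2 H.
Local Notation l2sqn := (dsqn (@l2_dot R H)).

Lemma sum_sqn_le x n : \sum_(k < n) sqn (l2_val x k) <= l2sqn x.
Proof.
rewrite -(big_mkord xpredT (fun k => sqn (l2_val x k))).
apply: nondecreasing_cvgn_le; last exact: is_cvg_sum_sqn.
by apply/nondecreasing_seqP => m; rewrite seriesSr lerDl sqn_ge0.
Qed.

Lemma l2sqn_le x (C : R) :
  (forall n, \sum_(k < n) sqn (l2_val x k) <= C) -> l2sqn x <= C.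
Proof.
move=> xC; apply: limr_le; first exact: is_cvg_sum_sqn.
by apply: nearW => n; rewrite /series/= big_mkord; exact: xC.
Qed.

Lemma l2_coord_sqn_le x k : sqn (l2_val x k) <= l2sqn x.
Proof.
apply: le_trans (sum_sqn_le x k.+1).
by rewrite big_ord_recr/= lerDr sumr_ge0// => i _; exact: sqn_ge0.
Qed.

Lemma l2_normE x : `|x| = (Num.sqrt (l2sqn x))%:C. Proof. by []. Qed.

Lemma l2_norm_le_sqn x (e : R) : 0 <= e -> `|x| <= e%:C -> l2sqn x <= e ^+ 2.
Proof.
move=> e0; rewrite l2_normE lecR => xe.
by rewrite -(sqr_sqrtr (sqn_ge0 x)) ler_pXn2r// ?nnegrE ?sqrtr_ge0.
Qed.

(** A Cauchy filter converges in each coordinate; near the filter the partial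
    sums of the squared distance to the coordinatewise limit [g] are bounded
    uniformly in their length, which puts [g] in the space and shows
    convergence to [g] in norm. *)
Lemma l2_complete (F : set_system (l2 H)) : ProperFilter F -> cauchy F -> cvg F.
Proof.
move=> FF Fc; apply/cvg_ex.
have Fball (e : R) : 0 < e ->
    \forall y \near F, \forall z \near F, l2sqn (y - z) <= e ^+ 2.
  move=> e0; have /cauchy_ballP/(_ e%:C) := Fc.
  rewrite ltcR => /(_ e0) /= Fe; near=> y; near=> z.
  apply: l2_norm_le_sqn; first exact: ltW.
  have : ball y e%:C z by near: z; near: y; apply: nearP_dep.
  by rewrite -ball_normE => /ltW.
have gP k : exists g : H, (l2_val x k @[x --> F]) --> g.
  apply/cvg_ex; apply: cauchy_cvg; apply/cauchy_ballP => e e0.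
  rewrite !near_simpl.
  have /cauchy_ballP/(_ e e0) := Fc; apply: filterS => -[x y] /=.
  rewrite -!ball_normE /= => xy; apply: le_lt_trans xy.
  rewrite hnormE l2_normE lecR ler_sqrt ?sqn_ge0//.
  exact: (l2_coord_sqn_le (x - y) k).
have [g gE] := choice gP.
have Fsum (e : R) : 0 < e ->
    \forall y \near F, forall n, \sum_(k < n) sqn (l2_val y k - g k) <= e ^+ 2.
  move=> e0; have e20 : 0 < e / 2 by rewrite divr_gt0.
  apply: filterS (Fball _ e20) => y Fy n.
  (* [y] is compared with [g] through one [z] whose first [n] coordinates are so
     close to those of [g] that the squared errors add up to at most
     [(e / 2) ^+ 2]. *)
  have d0 : 0 < (e / 2) / Num.sqrt n.+1%:R by rewrite divr_gt0// sqrtr_gt0.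
  have : \forall z \near F, forall k : 'I_n,
      sqn (l2_val z k - g k) <= ((e / 2) / Num.sqrt n.+1%:R) ^+ 2.
    apply: filter_forall => k.
    have /cvgrPdist_le/(_ ((e / 2) / Num.sqrt n.+1%:R)%:C) := gE (val k).
    rewrite ltcR => /(_ d0); apply: filterS => z.
    rewrite distrC hnormE lecR => zg.
    by rewrite -(sqr_sqrtr (sqn_ge0 _)) ler_pXn2r// nnegrE ?sqrtr_ge0// ltW.
  move=> Fz; near F => z.
  have zy : l2sqn (y - z) <= (e / 2) ^+ 2 by near: z.
  have zg : forall k : 'I_n,
      sqn (l2_val z k - g k) <= ((e / 2) / Num.sqrt n.+1%:R) ^+ 2 by near: z.
  apply: (@le_trans _ _ (\sum_(k < n)
      (sqn (l2_val (y - z) k) + (e / 2) ^+ 2 / n.+1%:R) *+ 2)).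
    apply: ler_sum => k _; rewrite -(subrK (l2_val z k) (l2_val y k)) -addrA.
    apply: le_trans (sqnD_le _ _) _; rewrite lerMn2r/= lerD//.
    by apply: le_trans (zg k) _; rewrite expr_div_n sqr_sqrtr.
  rewrite sumrMnl big_split/= sumr_const card_ord.
  have le1 := le_trans (sum_sqn_le (y - z) n) zy.
  have le2 : (e / 2) ^+ 2 / n.+1%:R *+ n <= (e / 2) ^+ 2.
    rewrite -mulr_natr -mulrA ler_piMr ?sqr_ge0// mulrC ler_pdivrMr// mul1r.
    by rewrite ler_nat.
  have -> : e ^+ 2 = ((e / 2) ^+ 2 + (e / 2) ^+ 2) *+ 2 by field.
  by rewrite lerMn2r/= lerD.
near F => y0.
have gl2 : g \in @l2_pred R H.
  have yg : (fun k => l2_val y0 k - g k) \in @l2_pred R H.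
    apply/asboolP; exists 1; rewrite -[1](expr1n _ 2).
    by near: y0; exact: Fsum.
  have -> : g = l2_val y0 - (fun k => l2_val y0 k - g k).
    by apply/funext => k; rewrite !fctE opprB addrC subrK.
  by rewrite rpredB// l2_valP.
exists (L2 gl2); apply/cvgrPdist_le => e e0; rewrite (gtc0_realE e0).
have re0 : 0 < complex.Re e by rewrite -ltcR -gtc0_realE.
apply: filterS (Fsum _ re0) => y Fy.
rewrite distrC l2_normE lecR -[leRHS](ger0_norm (ltW re0)) -sqrtr_sqr.
rewrite ler_sqrt ?sqr_ge0//.
by apply: l2sqn_le => n; exact: Fy.
Unshelve. all: by end_near. Qed.

HB.instance Definition _ := Uniform_isComplete.Build (l2 H) l2_complete.

Lemma l2_dot_norm (x : l2 H) : `|x| ^+ 2 = l2_dot x x.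
Proof. by rewrite l2_normE dotxx -rmorphXn/= sqr_sqrtr// sqn_ge0. Qed.

HB.instance Definition _ :=
  CompleteNormedModule_isHilbert.Build R (l2 H) l2_dot_norm.

End L2Complete.

(** * Orthogonal projections and reflections *)

Section Projection.
Context (R : realType) (H : hilbertType R).
Implicit Types x y z : H.

Lemma cvg_sqn (u : nat -> H) x (e : R) : u @ \oo --> x -> 0 < e ->
  \forall n \near \oo, sqn (x - u n) <= e.
Proof.
move=> /cvgrPdist_le ux e0.
have e2 : 0 < (Num.sqrt e)%:C :> R[i] by rewrite ltcR sqrtr_gt0.
apply: filterS (ux _ e2) => n; rewrite hnormE lecR ler_sqrt//.
exact: ltW.
Qed.

(** The usual minimizing sequence is Cauchy by the parallelogram identity.
    Minimality up to [n.+1%:R^-1] already bounds the inner products of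
    [x - u n] with the subspace, so orthogonality of [x - p] is obtained by
    passing to the limit in these bounds. *)
Lemma projection_ex (M : set H) : closed M -> M 0 ->
  (forall (a : R[i]) y z, M y -> M z -> M (a *: y + z)) ->
  forall x, exists2 p, M p & forall m, M m -> '[x - p, m] = 0.
Proof.
move=> Mcl M0 Mlin x.
pose D := [set sqn (x - m) | m in M]; pose d := inf D.
have Dinf : has_inf D.
  by split; [exists (sqn (x - 0)), 0|exists 0 => _ [m _ <-]; exact: sqn_ge0].
have dle m : M m -> d <= sqn (x - m).
  by move=> Mm; apply: ge_inf; [exact: Dinf.2|exists m].
have /choice[u uP] : forall n,
    exists y : H, M y /\ sqn (x - y) < d + n.+1%:R^-1.
  move=> n; have e0 : 0 < n.+1%:R^-1 :> R by rewrite invr_gt0.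
  have [_ [m Mm <-] md] := inf_adherent e0 Dinf.
  by exists m.
have MD y z : M y -> M z -> M (y + z).
  by move=> My Mz; rewrite -[y]scale1r; exact: Mlin.
have MZ (a : R[i]) y : M y -> M (a *: y).
  by move=> My; rewrite -[_ *: _]addr0; exact: Mlin.
(* Parallelogram identity at the midpoint of [u n] and [u k]. *)
have uC n k : (n <= k)%N -> sqn (u n - u k) <= 4 / n.+1%:R.
  move=> nk.
  have /dle : M ((2^-1 : R)%:C *: (u n + u k)).
    by apply: MZ; apply: MD; apply: (uP _).1.
  have -> : x - (2^-1 : R)%:C *: (u n + u k) =
     (2^-1 : R)%:C *: ((x - u n) + (x - u k)).
    rewrite [in RHS]addrACA -opprD scalerBr; congr (_ - _).
    rewrite scalerDr -scalerDl -rmorphD/=.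
    by rewrite (_ : 2^-1 + 2^-1 = 1 :> R) ?scale1r//; field.
  rewrite sqnZ /normsq/= expr0n addr0 sqnD => h.
  have -> : u n - u k = (x - u k) - (x - u n).
    by rewrite opprB [RHS]addrC addrA subrK.
  rewrite sqnB (dotReC (x - u n)).
  have h1 := (uP n).2; have h2 := (uP k).2.
  have : k.+1%:R^-1 <= n.+1%:R^-1 :> R by rewrite lef_pV2 ?posrE// ler_nat.
  set a := n.+1%:R^-1 in h1 *; set b := k.+1%:R^-1 in h2 *.
  move: h1 h2 h; rewrite (_ : 2^-1 ^+ 2 = 4^-1 :> R); last by field.
  lra.
have ucv : cvg (u @ \oo).
  apply: cauchy_cvg; apply: cauchy_exP => e e0.
  pose r := complex.Re e; have er : e = r%:C by exact: gtc0_realE.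
  have r0 : 0 < r by rewrite -ltcR -er.
  have [N _ NP] : \forall n \near \oo, n.+1%:R^-1 < r ^+ 2 / 4 :> R.
    have r4 : 0 < r ^+ 2 / 4 by rewrite divr_gt0 ?exprn_gt0.
    exact: (@near_infty_natSinv_lt R (PosNum r4)).
  exists (u N), N => // n /= Nn; rewrite -ball_normE/= hnormE er ltcR.
  rewrite -[r]gtr0_norm// -sqrtr_sqr ltr_sqrt ?exprn_gt0//.
  apply: le_lt_trans (uC _ _ Nn) _.
  have := NP N (leqnn N); set a := _^-1; rewrite /=; lra.
have [p up] := (cvg_ex _).1 ucv.
exists p.
  apply: (@closed_cvg _ _ _ _ u M Mcl _ p up).
  by apply: nearW => n; exact: (uP n).1.
have Re0 m : M m -> complex.Re '[x - p, m] = 0.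
  move=> Mm.
  have small n : complex.Re '[x - u n, m] ^+ 2 <= n.+1%:R^-1 * sqn m.
    apply: quadratic_ge0_discr; first exact: sqn_ge0.
    move=> t; have /dle : M (u n + t%:C *: m).
      by apply: MD (MZ _ _ Mm); exact: (uP n).1.
    rewrite opprD addrA sqnB sqnZ /normsq/= expr0n addr0 dotZr conjc_real.
    have -> : complex.Re (t%:C * '[x - u n, m]) = t * complex.Re '[x - u n, m].
      by case: '[_, _] => ? ? /=; ring.
    have := (uP n).2; set a := _^-1; lra.
  apply/eqP; rewrite -sqrf_eq0 eq_le sqr_ge0 andbT.
  apply/ler_addgt0Pr => e e0; rewrite add0r.
  have s0 : 0 < sqn m *+ 2 + 1 by rewrite ltr_pwDr// mulrn_wge0// sqn_ge0.
  have e4 : 0 < e / 2 / (sqn m *+ 2 + 1) by rewrite !divr_gt0.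
  near \oo => n.
  have h1 : sqn (p - u n) <= e / 2 / (sqn m *+ 2 + 1).
    by near: n; exact: cvg_sqn.
  have h2 : n.+1%:R^-1 <= e / 2 / (sqn m *+ 2 + 1).
    by apply: ltW; near: n; exact: (@near_infty_natSinv_lt R (PosNum e4)).
  have h3 := small n; have h4 := CauchySchwarz_Re (p - u n) m (f := hdot).
  have -> : x - p = (x - u n) - (p - u n) by rewrite opprB addrA subrK.
  rewrite dotBl ReB.
  have m0 : 0 <= sqn m by exact: sqn_ge0.
  have h5 := ler_wpM2r m0 h1; have h6 := ler_wpM2r m0 h2.
  set c := e / 2 / _ in h1 h2 h5 h6.
  have c0 : 0 < c by exact: e4.
  have h7 : c * sqn m * 2 + c = e / 2.
    by rewrite /c -mulr_natr; field; rewrite mulr_natr gt_eqF.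
  set A := complex.Re '[x - u n, m] in h3 *.
  set B := complex.Re '[p - u n, m] in h4 *.
  have : 0 <= (A + B) ^+ 2 by exact: sqr_ge0.
  have -> : (A - B) ^+ 2 = A ^+ 2 *+ 2 + B ^+ 2 *+ 2 - (A + B) ^+ 2 by ring.
  have A2 := le_trans h3 h6; have B2 := le_trans h4 h5.
  move: A2 B2 h7 c0 => {h1 h2 h3 h4 h5 h6}; clearbody A B c.
  move: (c * sqn m) (A ^+ 2) (B ^+ 2) ((A + B) ^+ 2) => w A2 B2 AB; lra.
move=> m Mm; apply/eqP; rewrite eq_complex Re0//= dotIm Re0 ?eqxx//.
exact: MZ.
Unshelve. all: by end_near. Qed.

End Projection.

(** Twice the projection minus the identity.  A decomposition together with the
    effect on it characterizes the reflection, and all further properties are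
    read off from these two clauses. *)
Lemma reflection_ex (R : realType) (K : hilbertType R) (M : set K) :
  closed M -> M 0 ->
  (forall (a : R[i]) y z, M y -> M z -> M (a *: y + z)) ->
  exists U : {linear K -> K},
    (forall x, exists a b,
      [/\ M a, forall m, M m -> '[b, m] = 0 & x = a + b]) /\
    (forall a b, M a -> (forall m, M m -> '[b, m] = 0) -> U (a + b) = a - b).
Proof.
move=> Mcl M0 Mlin.
have /choice[P PP] : forall x,
    exists p, M p /\ forall m, M m -> '[x - p, m] = 0.
  by move=> x; have [p Mp xp] := projection_ex Mcl M0 Mlin x; exists p.
have MB y z : M y -> M z -> M (y - z).
  by move=> My Mz; rewrite addrC -scaleN1r; exact: Mlin.
have Puniq x p : M p -> (forall m, M m -> '[x - p, m] = 0) -> P x = p.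
  move=> Mp xp; have [MPx xPx] := PP x.
  have Md := MB _ _ MPx Mp.
  apply/eqP; rewrite -subr_eq0; apply/eqP/(sqn_eq0 (f := hdot)).
  have h : '[P x - x, P x - p] = 0.
    have := xPx _ Md; rewrite !dotBl => /eqP; rewrite subr_eq0 => /eqP ->.
    by rewrite subrr.
  by rewrite /dsqn -{1}(subrK x (P x)) -addrA dotDl xp// addr0 h.
have Plin : linear P.
  move=> a x y; apply: Puniq; first by apply: Mlin; exact: (PP _).1.
  move=> m Mm; rewrite opprD addrACA -scalerBr dotDl dotZl.
  by rewrite !(PP _).2// mulr0 addr0.
have Ulin : linear (fun x => P x - (x - P x)).
  move=> a x y; rewrite Plin scalerBr addrACA; congr (_ + _).
  by rewrite -opprD; congr (- _); rewrite scalerBr opprD addrACA.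
pose U := mk_linear Ulin.
exists U; split=> [x|a b Ma bM].
  exists (P x), (x - P x); have [MP xP] := PP x; split=> //.
  by rewrite addrC subrK.
by rewrite /U /= (Puniq (a + b) a) ?[a + b]addrC ?addrK.
Qed.

(** * Bounded operators, the Riesz representation and adjoints *)

Section BoundedOps.
Context (R : realType).
Implicit Types (H K : hilbertType R).

Definition sq_bounded H K (f : H -> K) :=
  exists2 C : R, 0 <= C & forall x, sqn (f x) <= C * sqn x.

Lemma sq_boundedP H K (f : {linear H -> K}) :
  bounded_near f (nbhs (0 : H)) <-> sq_bounded f.
Proof.
split=> [/linear_boundedP/pinfty_ex_gt0[r r0 fr]|[C C0 fC]].
  exists (complex.Re r ^+ 2); first exact: sqr_ge0.
  move=> x; rewrite -le_norm_sqn -?gtc0_realE//.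
  by apply: ltW; rewrite -ltcR -gtc0_realE.
apply/bounded_funP => r; exists ((Num.sqrt C)%:C * r) => x xr.
apply: (@le_trans _ _ ((Num.sqrt C)%:C * `|x|)).
  by rewrite le_norm_sqn ?sqrtr_ge0// sqr_sqrtr.
by rewrite ler_wpM2l// lecR sqrtr_ge0.
Qed.

Lemma op_sq_bounded H K (f : boundedOp H K) : sq_bounded f.
Proof. by apply/sq_boundedP; exact: op_bounded. Qed.

Section MakeOp.
Context (H K : hilbertType R) (f : H -> K).
Hypotheses (flin : linear f) (fb : sq_bounded f).

Lemma mk_op_bounded : bounded_near f (nbhs (0 : H)).
Proof. by apply/(@sq_boundedP _ _ (mk_linear flin)). Qed.

Definition mk_op : boundedOp H K :=
  HB.pack f (GRing.isLinear.Build R[i] H K *:%R f flin)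
    (isBoundedOp.Build R[i] H K f mk_op_bounded).

End MakeOp.

End BoundedOps.

Lemma sq_bounded_isom (R : realType) (H K : hilbertType R) (f : H -> K) :
  (forall x, sqn (f x) = sqn x) -> sq_bounded f.
Proof. by move=> fE; exists 1 => // x; rewrite fE mul1r. Qed.

Lemma sq_boundedD (R : realType) (H K : hilbertType R) (f g : H -> K) :
  sq_bounded f -> sq_bounded g -> sq_bounded (fun x => f x + g x).
Proof.
move=> [C C0 fC] [D D0 gD]; exists ((C + D) *+ 2).
  by rewrite mulrn_wge0// addr_ge0.
move=> x; apply: le_trans (sqnD_le _ _) _.
by rewrite mulrnAl lerMn2r/= mulrDl lerD.
Qed.

Lemma sq_boundedB (R : realType) (H K : hilbertType R) (f g : H -> K) :
  sq_bounded f -> sq_bounded g -> sq_bounded (fun x => f x - g x).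
Proof.
move=> fb [D D0 gD]; apply: sq_boundedD => //.
by exists D => // x; rewrite sqnN.
Qed.

Lemma sq_bounded_comp (R : realType) (H K L : hilbertType R)
    (f : K -> L) (g : H -> K) :
  sq_bounded f -> sq_bounded g -> sq_bounded (fun x => f (g x)).
Proof.
move=> [C C0 fC] [D D0 gD]; exists (C * D); first exact: mulr_ge0.
by move=> x; apply: le_trans (fC _) _; rewrite -mulrA ler_wpM2l.
Qed.

Section Riesz.
Context (R : realType) (H : hilbertType R).
Implicit Types (x y z : H).

Lemma normsq_hdot_le x y : normsq '[x, y] <= 2 * sqn x * sqn y.
Proof.
have h1 := CauchySchwarz_Re (f := hdot) x y.
have h2 := CauchySchwarz_Re (f := hdot) x ('i *: y).
move: h2; rewrite -dotIm sqnZ /normsq/= expr0n expr1n add0r mul1r => h2.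
by rewrite -mulrA mulr2n mulrDl mul1r lerD.
Qed.

(** Closedness of the kernel of a bounded functional, for whole families: this
    serves the Riesz theorem, the range of the inclusion and the mirror of the
    reflection alike. *)
Lemma closed_kernel (I : Type) (phi : I -> H -> R[i]) :
  (forall i, additive (phi i)) ->
  (forall i, exists2 C : R, 0 <= C & forall x, normsq (phi i x) <= C * sqn x) ->
  closed [set x | forall i, phi i x = 0].
Proof.
move=> phiB phib x xM i; apply: normsq_eq0; apply/eqP.
have [C C0 phiC] := phib i.
rewrite eq_le normsq_ge0 andbT; apply/ler_addgt0Pr => e e0; rewrite add0r.
have C1 : 0 < C + 1 by rewrite ltr_pwDr.
have d0 : 0 < (Num.sqrt (e / (C + 1)))%:C :> R[i].
  by rewrite ltcR sqrtr_gt0 divr_gt0.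
have [m [mM]] := xM _ (nbhsx_ballx x _ d0).
rewrite -ball_normE/= hnormE ltcR ltr_sqrt ?divr_gt0// => xm.
have -> : phi i x = phi i (x - m) by rewrite phiB mM subr0.
apply: le_trans (phiC _) _.
apply: (@le_trans _ _ (C * (e / (C + 1)))); first by rewrite ler_wpM2l// ltW.
by rewrite mulrCA ler_piMr ?(ltW e0)// ler_pdivrMr// mul1r lerDl.
Qed.

(** For [v] orthogonal to the kernel, [phi v *: x - phi x *: v] lies in the
    kernel; pairing it with [v] expresses [phi x] through ['[x, v]]. *)
Theorem riesz (phi : H -> R[i]) : scalar phi ->
  (exists2 C : R, 0 <= C & forall x, normsq (phi x) <= C * sqn x) ->
  exists z, forall x, phi x = '[x, z].
Proof.
move=> philin phib.
have phiB : additive phi.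
  by move=> x y; rewrite -[in LHS]scaleN1r addrC philin mulN1r addrC.
have phi0 : phi 0 = 0 by rewrite -[0](subrr 0) phiB subrr.
have phiZ a x : phi (a *: x) = a * phi x.
  by rewrite -[_ *: _]addr0 philin phi0 addr0.
have [phi_0|/existsNP[x0 /eqP x0N]] := pselect (forall x, phi x = 0).
  by exists 0 => x; rewrite phi_0 dot0r.
have [] := @projection_ex R H [set x | phi x = 0] _ phi0 _ x0.
- have := @closed_kernel unit (fun=> phi) (fun=> phiB) (fun=> phib).
  by congr closed; apply/seteqP; split=> x; [exact|move=> h []].
- by move=> a y z; rewrite /= philin => -> ->; rewrite mulr0 addr0.
move=> p /= pM; set v := x0 - p => vM.
have phiv : phi v != 0 by rewrite phiB pM subr0.
have v0 : sqn v != 0.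
  by apply: contra_neq phiv => /sqn_eq0 ->.
exists (((phi v)^*%C * ((sqn v)^-1)%:C) *: v) => x.
have /vM : phi (phi v *: x - phi x *: v) = 0 by rewrite phiB !phiZ mulrC subrr.
rewrite dotBr !dotZr dotxx => /eqP; rewrite subr_eq0 => /eqP h.
have {}h : phi v * '[x, v] = phi x * (sqn v)%:C.
  by have := congr1 (@conjc R) h; rewrite !conjcM !conjcK -dotC conjc_real.
by rewrite conjcM conjcK conjc_real mulrAC h -mulrA -rmorphM/= mulfV// mulr1.
Qed.

Theorem adjoint_ex (A : 'B(H)) : exists A' : 'B(H), is_adjoint A A'.
Proof.
have [C C0 AC] := op_sq_bounded A.
have /choice[A' A'E] : forall w, exists z, forall x, '[A x, w] = '[x, z].
  move=> w; apply: riesz; first by move=> a x y; rewrite linearP dotDl dotZl.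
  exists (2 * C * sqn w); first by rewrite !mulr_ge0// sqn_ge0.
  move=> x; apply: le_trans (normsq_hdot_le _ _) _.
  by rewrite [leRHS]mulrAC ler_wpM2r ?sqn_ge0// -!mulrA ler_wpM2l// AC.
have ext x y : (forall z, '[z, x] = '[z, y]) -> x = y.
  by move=> xy; apply: hdot_extl => z; rewrite dotC xy -dotC.
have A'lin : linear A'.
  by move=> a x y; apply: ext => z; rewrite -A'E !dotDr !dotZr !A'E.
have A'b : sq_bounded A'.
  exists C => // w; have [->|w0] := eqVneq (sqn (A' w)) 0.
    by rewrite mulr_ge0// sqn_ge0.
  have wp : 0 < sqn (A' w) by rewrite lt_neqAle eq_sym w0 sqn_ge0.
  rewrite -(ler_pM2l wp) -expr2 {1}/dsqn -A'E.
  apply: le_trans (CauchySchwarz_Re _ _) _.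
  by rewrite mulrA ler_wpM2r ?sqn_ge0// mulrC AC.
by exists (mk_op A'lin A'b) => x y; exact: A'E.
Qed.

End Riesz.

(** * Defect maps *)

(** For [0 <= X <= 1], iterating [X |-> X - X^2] splits [X] into squares:
    [X_0 = X_0^2 + ... + X_(n-1)^2 + X_n] with [0 <= X_n <= 1].  The terms
    [X_n x] are square-summable, so [X_n x] tends to 0, and
    [x |-> (X_n x)_n] is a map into the space of sequences whose squared norm
    is [<X x, x>].  It takes the place of the square root of [X]. *)

Section Effects.
Context (R : realType) (H : hilbertType R).
Implicit Types (x y z : H) (X : H -> H).

Definition effect X := [/\ linear X, forall x y, '[X x, y] = '[x, X y] &
  forall x, 0 <= complex.Re '[X x, x] <= sqn x].

(** This is [X - X^2 = X (1 - X) X + (1 - X) X (1 - X) >= 0]. *)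
Lemma effect_sqn_le X x : effect X -> sqn (X x) <= complex.Re '[X x, x].
Proof.
move=> [Xlin Xsym Xpos].
have /andP[h1 _] := Xpos (x - X x); have /andP[_ h2] := Xpos (X x).
have XB y z : X (y - z) = X y - X z.
  by rewrite -[y - z]addrC -scaleN1r Xlin scaleN1r addrC.
move: h1; rewrite XB dotBl !dotBr (Xsym (X x) x) !ReB -/(sqn (X x)).
lra.
Qed.

Lemma effect_next X : effect X -> effect (fun x => X x - X (X x)).
Proof.
move=> XE; have [Xlin Xsym Xpos] := XE; split.
- by move=> a x y; rewrite !Xlin scalerBr opprD addrACA.
- by move=> x y; rewrite dotBl dotBr !Xsym.
move=> x; rewrite dotBl ReB (Xsym (X x)) -/(sqn (X x)).
have := effect_sqn_le x XE; have /andP[h1 h2] := Xpos x.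
have := @sqn_ge0 R H hdot (X x); lra.
Qed.

Variable X0 : H -> H.
Hypothesis X0E : effect X0.

Fixpoint effect_iter n : H -> H :=
  if n is m.+1 then fun x => effect_iter m x - effect_iter m (effect_iter m x)
  else X0.

Lemma effect_iterP n : effect (effect_iter n).
Proof. by elim: n => [//|n IH]; exact: effect_next. Qed.

Lemma effect_iter_sum n x :
  \sum_(k < n) sqn (effect_iter k x) =
  complex.Re '[X0 x, x] - complex.Re '[effect_iter n x, x].
Proof.
elim: n => [|n IH]; first by rewrite big_ord0 subrr.
rewrite big_ord_recr IH /= dotBl ReB; have [_ sym _] := effect_iterP n.
by rewrite (sym (effect_iter n x)) -/(sqn (effect_iter n x)) /dsqn; ring.
Qed.

Lemma effect_iter_l2 x : (fun k => effect_iter k x) \in @l2_pred R H.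
Proof.
apply/asboolP; exists (complex.Re '[X0 x, x]) => n.
have [_ _ /(_ x)/andP[h _]] := effect_iterP n.
by rewrite effect_iter_sum lerBlDr lerDl.
Qed.

Definition effect_root x : l2 H := L2 (effect_iter_l2 x).

Lemma effect_root_linear : linear effect_root.
Proof.
move=> a x y; apply/val_inj/funext => k.
by have [lin _ _] := effect_iterP k; exact: lin.
Qed.

(** The remainder [<X_n x, x>] vanishes in the limit by the Cauchy-Schwarz
    inequality, because [|X_n x|^2] is the general term of a convergent
    series. *)
Lemma effect_root_sqn x : sqn (effect_root x) = complex.Re '[X0 x, x].
Proof.
pose q n := complex.Re '[effect_iter n x, x].
have q0 n : 0 <= q n by have [_ _ /(_ x)/andP[]] := effect_iterP n.
have a0 : sqn (effect_iter n x) @[n --> \oo] --> (0 : R).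
  exact: (@cvg_series_cvg_0 R R^o) (@is_cvg_sum_sqn _ _ (effect_root x)).
have qcvg : q @ \oo --> (0 : R).
  apply/cvgr0Pnorm_le => e e0.
  have d0 : 0 < e ^+ 2 / (sqn x + 1).
    by rewrite divr_gt0 ?exprn_gt0// ltr_pwDr// sqn_ge0.
  move/cvgr0Pnorm_le/(_ _ d0): a0; apply: filterS => n.
  rewrite ger0_norm ?sqn_ge0// => an; rewrite ger0_norm//.
  rewrite -(@ler_pXn2r _ 2)// ?nnegrE ?(ltW e0)//.
  apply: le_trans (CauchySchwarz_Re _ _) _.
  apply: le_trans (ler_wpM2r (sqn_ge0 (f := hdot) x) an) _.
  rewrite -mulrA ler_piMr ?sqr_ge0// mulrC ler_pdivrMr ?mul1r ?lerDl//.
  by rewrite ltr_pwDr// sqn_ge0.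
apply: cvg_lim => //.
rewrite (_ : series _ = fun n => q 0 - q n); last first.
  by apply/funext => n; rewrite /series/= big_mkord effect_iter_sum.
rewrite -[X in _ --> X]subr0; apply: cvgB => //; exact: cvg_cst.
Qed.

End Effects.

(** The case [X = 1 - T^* T]. *)
Lemma defect_ex (R : realType) (H : hilbertType R) (T : 'B(H)) :
  contractive T ->
  exists2 D : H -> l2 H, linear D & forall x, sqn (D x) = sqn x - sqn (T x).
Proof.
move=> /contractiveP Tc; have [T' TT'] := adjoint_ex T.
have sqT x : sqn (T x) <= sqn x.
  by have := Tc x; rewrite !hnormE lecR ler_sqrt// sqn_ge0.
pose X0 x := x - T' (T x).
have X0q x : complex.Re '[X0 x, x] = sqn x - sqn (T x).
  by rewrite /X0 dotBl ReB (dotReC x (T' (T x))) -TT'.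
have X0E : effect X0.
  split.
  - move=> a x y.
    by rewrite /X0 (linearP T) (linearP T') scalerBr opprD addrACA.
  - move=> x y; rewrite /X0 dotBl dotBr; congr (_ - _).
    by rewrite dotC -TT' -dotC TT'.
  - by move=> x; rewrite X0q subr_ge0 sqT/= lerBlDr lerDl sqn_ge0.
exists (effect_root X0E); first exact: effect_root_linear.
by move=> x; rewrite effect_root_sqn.
Qed.

(** * Moving coordinates along an increasing map *)

(** Placing the coordinates of a sequence at the indices [f 0 < f 1 < ...] is
    an isometry, with adjoint the reading of the coordinates at these indices.
    Monotonicity of [f] makes the partial sums of the one series a subsequence
    of those of the other, so that no rearrangement of series is involved. *)

Section Reindexing.
Context (R : realType) (H : hilbertType R) (f : nat -> nat).
Hypothesis fmono : {homo f : m n / (m < n)%N}.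
Implicit Types (x y : l2 H).

Lemma leq_mono n : (n <= f n)%N.
Proof. by elim: n => // n IH; exact: leq_ltn_trans IH (fmono (ltnSn n)). Qed.

Lemma mono_inj : injective f.
Proof.
move=> m n fmn; case: (ltngtP m n) => // /fmono; by rewrite fmn ltnn.
Qed.

Lemma sum_range (V : nmodType) (F : nat -> V) M :
  (forall n, (forall m, f m != n) -> F n = 0) ->
  \sum_(n < f M) F n = \sum_(m < M) F (f m).
Proof.
move=> F0; rewrite -(big_mkord xpredT F).
elim: M => [|M IH].
  rewrite big_ord0 big_nat_cond big1// => n /andP[/andP[_ nf] _].
  apply: F0 => m; apply: contraTneq nf => <-; rewrite -leqNgt.
  by case: m => // m; exact: ltnW (fmono _).
have fM := fmono (ltnSn M).
rewrite big_ord_recr -IH (big_cat_nat (leq0n _) (ltnW fM))/= (big_ltn fM).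
congr (_ + _).
rewrite big_nat_cond big1 ?addr0// => n /andP[/andP[fMn nfM] _].
apply: F0 => m; apply/eqP => fmn; move: fMn nfM; rewrite -fmn.
case: (ltngtP m M) => [/fmono h1 h2|Mm _|->]; last by rewrite ltnn.
  by move: (ltn_trans h1 h2); rewrite ltnn.
rewrite ltnNge; move: Mm; rewrite leq_eqVlt => /predU1P[->|/fmono/ltnW->//].
by rewrite leqnn.
Qed.

Definition push_fun (x : nat -> H) n : H :=
  if [pick m : 'I_n.+1 | f m == n] is Some m then x m else 0.

Lemma push_funE (x : nat -> H) m : push_fun x (f m) = x m.
Proof.
rewrite /push_fun; case: pickP => [k /eqP/mono_inj -> //|].
by move=> /(_ (inord m)); rewrite inordK ?ltnS ?leq_mono// eqxx.
Qed.

Lemma push_fun_out (x : nat -> H) n : (forall m, f m != n) -> push_fun x n = 0.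
Proof.
by move=> fn; rewrite /push_fun; case: pickP => // m; rewrite (negPf (fn m)).
Qed.

Lemma push_l2 x : push_fun (l2_val x) \in @l2_pred R H.
Proof.
apply/asboolP; exists (sqn x) => n.
apply: (@le_trans _ _ (\sum_(k < f n) sqn (push_fun (l2_val x) k))).
  rewrite -(subnKC (leq_mono n)) big_split_ord/= lerDl sumr_ge0// => k _.
  exact: sqn_ge0.
rewrite (@sum_range _ (fun k => sqn (push_fun (l2_val x) k))); last first.
  by move=> k fk; rewrite push_fun_out// sqn0.
by under eq_bigr do rewrite push_funE; exact: sum_sqn_le.
Qed.

Lemma pull_l2 x : l2_val x \o f \in @l2_pred R H.
Proof.
apply/asboolP; exists (sqn x) => n.
pose F k := sqn (push_fun (l2_val x \o f) k).
have FE m : F (f m) = sqn (l2_val x (f m)) by rewrite /F push_funE.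
under eq_bigr do rewrite /= -FE.
rewrite -sum_range; last by move=> k fk; rewrite /F push_fun_out// sqn0.
apply: le_trans (sum_sqn_le x (f n)); apply: ler_sum => k _; rewrite /F.
have [[m <-]|kf] := pselect (exists m, f m = k); first by rewrite push_funE.
rewrite push_fun_out ?sqn0 ?sqn_ge0// => m; apply/eqP => fm; apply: kf.
by exists m.
Qed.

Definition push x := L2 (push_l2 x).
Definition pull x := L2 (pull_l2 x).

Lemma pushE x m : l2_val (push x) (f m) = l2_val x m.
Proof. exact: push_funE. Qed.

Lemma push_out x n : (forall m, f m != n) -> l2_val (push x) n = 0.
Proof. exact: push_fun_out. Qed.

Lemma pushK : cancel push pull.
Proof. by move=> x; apply/val_inj/funext => m; rewrite /= push_funE. Qed.

Lemma push_linear : linear push.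
Proof.
move=> a x y; apply/val_inj/funext => n.
have [[m <-]|kf] := pselect (exists m, f m = n).
  by rewrite [LHS]pushE [RHS]l2_valD l2_valZ !pushE.
have fn m : f m != n by apply/eqP => fm; apply: kf; exists m.
by rewrite [LHS]push_out// [RHS]l2_valD l2_valZ !push_out// scaler0 addr0.
Qed.

Lemma pull_linear : linear pull.
Proof. by move=> a x y; apply/val_inj. Qed.

Lemma lim_sum_range (F : R^nat) (l : R) :
  (forall n, (forall m, f m != n) -> F n = 0) ->
  series F @ \oo --> l -> limn (series (F \o f)) = l.
Proof.
move=> F0 Fl; apply: cvg_lim => //.
rewrite (_ : series (F \o f) = series F \o f).
  apply: cvg_comp Fl => A [N _ NA]; exists N => // n /= Nn.
  exact: NA (leq_trans Nn (leq_mono n)).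
by apply/funext => n; rewrite /series/= !big_mkord sum_range.
Qed.

Lemma push_adjoint x y : '[push x, y] = '[x, pull y].
Proof.
apply/eqP; rewrite eq_complex; apply/andP; split; apply/eqP; apply/esym.
  rewrite -[RHS](lim_sum_range _ (@is_cvg_dotRe _ _ (push x) y)); last first.
    by move=> n fn; rewrite push_out// dot0l.
  by congr (limn (series _)); apply/funext => m /=; rewrite push_funE.
rewrite -[RHS](lim_sum_range _ (@is_cvg_dotIm _ _ (push x) y)); last first.
  by move=> n fn; rewrite push_out// dot0l.
by congr (limn (series _)); apply/funext => m /=; rewrite push_funE.
Qed.

End Reindexing.

Lemma pull_push_disjoint (R : realType) (H : hilbertType R) (f g : nat -> nat)
    (fmono : {homo f : m n / (m < n)%N}) (gmono : {homo g : m n / (m < n)%N})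
    (x : l2 H) :
  (forall m n, f m != g n) -> pull fmono (push gmono x) = 0.
Proof.
move=> fg; apply/val_inj/funext => m /=.
by rewrite push_fun_out// => n; rewrite eq_sym fg.
Qed.

Section Coordinate.
Context (R : realType) (H : hilbertType R).
Implicit Types (h : H) (x : l2 H).

Lemma single_l2 h : (fun n => if n is 0 then h else 0) \in @l2_pred R H.
Proof.
apply/asboolP; exists (sqn h) => -[|n]; first by rewrite big_ord0 sqn_ge0.
by rewrite big_ord_recl/= big1 ?addr0// => k _; rewrite sqn0.
Qed.

Definition single h := L2 (single_l2 h).

Lemma single_linear : linear single.
Proof.
move=> a x y; apply/val_inj/funext => -[//|n].
by rewrite [RHS]l2_valD l2_valZ/= scaler0 addr0.
Qed.

Lemma single_adjoint h x : '[single h, x] = '[h, l2_val x 0].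
Proof.
have lim1 (F : R^nat) : (forall n, F n.+1 = 0) -> limn (series F) = F 0.
  move=> F0; apply: cvg_lim => //; apply: cvg_near_cst.
  exists 1 => // -[|n] //= _.
  by rewrite /series/= big_mkord big_ord_recl/= big1 ?addr0.
apply/eqP; rewrite eq_complex; apply/andP; split; apply/eqP.
  by apply: lim1 => n /=; rewrite dot0l.
by apply: lim1 => n /=; rewrite dot0l.
Qed.

End Coordinate.

(** * Ando's construction with a reflection *)

Lemma polarization (R : realType) (H K L : hilbertType R)
    (A : {linear H -> K}) (B : {linear H -> L}) :
  (forall x, sqn (A x) = sqn (B x)) -> forall x y, '[A x, A y] = '[B x, B y].
Proof.
move=> AB.
have ReE x y : complex.Re '[A x, A y] = complex.Re '[B x, B y].
  by have := AB (x + y); rewrite !linearD !sqnD !AB; lra.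
move=> x y; apply/eqP; rewrite eq_complex ReE eqxx/= !dotIm.
by rewrite -!linearZ/= ReE.
Qed.

(** In what follows [J] is an isometry with adjoint [p], and [s] is an isometry
    with adjoint [s'].  The condition [p \o s =1 p], together with [s'] undoing
    [s], makes [s] fix the range of [J] and preserve its orthogonal
    complement. *)
Section ShiftedDilation.
Context (R : realType) (H K : hilbertType R).
Variables (J : {linear H -> K}) (p : {linear K -> H}) (s s' : {linear K -> K}).
Hypothesis Jp : forall h y, '[J h, y] = '[h, p y].
Hypothesis pJ : forall h, p (J h) = h.
Hypothesis ss' : forall x y, '[s x, y] = '[x, s' y].
Hypothesis s's : forall x, s' (s x) = x.
Hypothesis ps : forall x, p (s x) = p x.

Lemma s's_r x y : '[x, s y] = '[s' x, y].
Proof. by rewrite dotC ss' -dotC. Qed.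

Lemma s_isom x y : '[s x, s y] = '[x, y].
Proof. by rewrite ss' s's. Qed.

Lemma sqn_s x : sqn (s x) = sqn x.
Proof. by rewrite /dsqn s_isom. Qed.

Lemma sqn_J h : sqn (J h) = sqn h.
Proof. by rewrite /dsqn Jp pJ. Qed.

Section Lift.
Variables (T : {linear H -> H}) (d : {linear H -> K}).
Hypothesis pd : forall h, p (d h) = 0.
Hypothesis s'd : forall h, s' (d h) = 0.
Hypothesis dE : forall h, sqn (d h) = sqn h - sqn (T h).

(** Schaeffer's isometric dilation: the defect of [T] is stored in a part of the
    space which is orthogonal to the range of [s]. *)
Definition lift_fun x := J (T (p x)) + d (p x) + s (x - J (p x)).

Lemma lift_linear : linear lift_fun.
Proof.
move=> a x y; rewrite /lift_fun.
rewrite !(linearP p) !(linearP T) !(linearP d) !(linearP J)/=.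
rewrite [in LHS](_ : a *: x + y - _ = a *: (x - J (p x)) + (y - J (p y))).
  by rewrite linearP/= [X in X + _ = _]addrACA [LHS]addrACA !scalerDr.
by rewrite scalerBr opprD addrACA.
Qed.

Lemma p_lift x : p (lift_fun x) = T (p x).
Proof.
by rewrite /lift_fun !(linearD p) pJ pd ps (linearB p) pJ subrr !addr0.
Qed.

Lemma sqn_lift x : sqn (lift_fun x) = sqn x.
Proof.
have Jo y : '[J y, s (x - J (p x))] = 0.
  by rewrite Jp ps (linearB p) pJ subrr dot0r.
rewrite /lift_fun sqnDo; last first.
  by rewrite dotDl Jo s's_r s'd dot0l addr0.
rewrite sqnDo; last by rewrite Jp pd dot0r.
rewrite sqn_J dE sqn_s addrC sqnB dotReC Jp -/(sqn (p x)) sqn_J; ring.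
Qed.

End Lift.

(** The isometries [e1] and [e3] insert copies of [L] in mutually orthogonal
    subspaces, both orthogonal to the ranges of [J] and [s].  The defects of
    [T1] and [T1'] go through [e1] and that of [T2] through [e3]; in the
    products of two lifts, [defect12] and [defect21] below then have orthogonal
    ranges. *)
Section Intertwining.
Context (L : hilbertType R).
Variables (e1 e3 : {linear L -> K}) (e1' e3' : {linear K -> L}).
Hypothesis e1e : forall x y, '[e1 x, y] = '[x, e1' y].
Hypothesis e3e : forall x y, '[e3 x, y] = '[x, e3' y].
Hypothesis e1K : forall x, e1' (e1 x) = x.
Hypothesis e3K : forall x, e3' (e3 x) = x.
Hypothesis e13 : forall x, e1' (e3 x) = 0.
Hypothesis pe1 : forall x, p (e1 x) = 0.
Hypothesis pe3 : forall x, p (e3 x) = 0.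
Hypothesis s'e1 : forall x, s' (e1 x) = 0.
Hypothesis s'e3 : forall x, s' (e3 x) = 0.

Variables (T1 T1' T2 : {linear H -> H}) (D1 D1' D2 : {linear H -> L}).
Hypothesis T12 : forall h, T1 (T2 h) = T2 (T1' h).
Hypothesis D1E : forall h, sqn (D1 h) = sqn h - sqn (T1 h).
Hypothesis D1'E : forall h, sqn (D1' h) = sqn h - sqn (T1' h).
Hypothesis D2E : forall h, sqn (D2 h) = sqn h - sqn (T2 h).

Definition defect12 h := e1 (D1 (T2 h)) + s (e3 (D2 h)).
Definition defect21 h := e3 (D2 (T1' h)) + s (e1 (D1' h)).

Lemma sqn_e1 x : sqn (e1 x) = sqn x.
Proof. by rewrite /dsqn e1e e1K. Qed.

Lemma sqn_e3 x : sqn (e3 x) = sqn x.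
Proof. by rewrite /dsqn e3e e3K. Qed.

Lemma defect12_linear : linear defect12.
Proof. by move=> a x y; rewrite /defect12 !linearP/= scalerDr addrACA. Qed.

Lemma defect21_linear : linear defect21.
Proof. by move=> a x y; rewrite /defect21 !linearP/= scalerDr addrACA. Qed.

(** By telescoping, the two sides are [|h|^2 - |T1 T2 h|^2] and
    [|h|^2 - |T2 T1' h|^2]. *)
Lemma sqn_defect12 h : sqn (defect12 h) = sqn (defect21 h).
Proof.
rewrite /defect12 /defect21 !sqnDo ?s's_r ?s'e1 ?s'e3 ?dot0l//.
rewrite !sqn_s !sqn_e1 !sqn_e3 D1E D1'E !D2E T12; ring.
Qed.

Lemma hdot_defect12 h k : '[defect12 h, defect12 k] = '[defect21 h, defect21 k].
Proof.
exact: (@polarization _ _ _ _ (mk_linear defect12_linear)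
  (mk_linear defect21_linear) sqn_defect12).
Qed.

Lemma hdot_defect12_21 h k : '[defect12 h, defect21 k] = 0.
Proof.
rewrite /defect12 /defect21 dotDl !dotDr (e1e _ (e3 _)) e13 dot0r.
rewrite s's_r s'e1 dot0l ss' s'e3 dot0r s_isom dotC (e1e _ (e3 _)) e13 dot0r.
by rewrite rmorph0 !addr0.
Qed.

Lemma p_defect12 h : p (defect12 h) = 0.
Proof. by rewrite /defect12 (linearD p) pe1 ps pe3 addr0. Qed.

Lemma p_defect21 h : p (defect21 h) = 0.
Proof. by rewrite /defect21 (linearD p) pe3 ps pe1 addr0. Qed.

Lemma s's'defect12 h : s' (s' (defect12 h)) = 0.
Proof. by rewrite /defect12 !(linearD s') s'e1 s's s'e3 linear0 addr0. Qed.

Lemma s's'defect21 h : s' (s' (defect21 h)) = 0.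
Proof. by rewrite /defect21 !(linearD s') s'e3 s's s'e1 linear0 addr0. Qed.

Definition shift2 n x := iter n (fun y => s (s y)) x.

Lemma p_shift2 n x : p (shift2 n x) = p x.
Proof. by elim: n => //= n IH; rewrite !ps IH. Qed.

Lemma sqn_shift2 n x : sqn (shift2 n x) = sqn x.
Proof. by elim: n => //= n IH; rewrite !sqn_s IH. Qed.

(** The fixed space of the reflection: vectors on which exchanging [defect12 h]
    with [defect21 h], in every block of the shift [s \o s], has no effect. *)
Definition mirror : set K := [set y | forall nh : nat * H,
  '[y, shift2 nh.1 (defect12 nh.2 - defect21 nh.2)] = 0].

Lemma mirror_closed : closed mirror.
Proof.
apply: (@closed_kernel R K _
  (fun nh y => '[y, shift2 nh.1 (defect12 nh.2 - defect21 nh.2)])).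
  by move=> nh x y; rewrite dotBl.
move=> nh; exists (2 * sqn (defect12 nh.2 - defect21 nh.2)).
  by rewrite mulr_ge0// sqn_ge0.
move=> x; apply: le_trans (normsq_hdot_le _ _) _.
by rewrite sqn_shift2 mulrAC.
Qed.

Lemma mirror0 : mirror 0. Proof. by move=> nh; rewrite dot0l. Qed.

Lemma mirror_linear (a : R[i]) y z :
  mirror y -> mirror z -> mirror (a *: y + z).
Proof. by move=> My Mz nh; rewrite dotDl dotZl My Mz mulr0 addr0. Qed.

(** The copy of [H] is fixed, so the reflection does not spoil the lifting
    property. *)
Lemma mirror_J h : mirror (J h).
Proof.
move=> nh.
by rewrite Jp p_shift2 (linearB p) p_defect12 p_defect21 subrr dot0r.
Qed.

Lemma mirror_defectD h : mirror (defect12 h + defect21 h).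
Proof.
move=> [[|n] k] /=.
  rewrite dotDl !dotBr hdot_defect12_21 hdot_defect12.
  by rewrite (hdot_eq0C (hdot_defect12_21 _ _)) subr0 sub0r subrr.
rewrite !s's_r (linearD s' (defect12 h)) (linearD s' (s' _)).
by rewrite s's'defect12 s's'defect21 addr0 dot0l.
Qed.

(** Invariance of the mirror under [s \o s] and its adjoint is what makes the
    reflection commute with [s \o s]. *)
Lemma mirror_s y : mirror y -> mirror (s (s y)).
Proof.
move=> My [[|n] k] /=; last by rewrite !s_isom (My (n, k)).
rewrite !ss' (linearB s' (defect12 k)) (linearB s' (s' _)).
by rewrite s's'defect12 s's'defect21 subrr dot0r.
Qed.

Lemma mirror_s' y : mirror y -> mirror (s' (s' y)).
Proof. by move=> My [n k] /=; rewrite -!s's_r; exact: (My (n.+1, k)). Qed.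

(** An equality of the form [W1 W2 = W2 W1'] fails only in the inserted defects,
    and the reflection [U], which exchanges them, repairs it. *)
Theorem isometric_intertwining :
  exists V1 V2 V1' : {linear K -> K},
    [/\ [/\ forall x, p (V1 x) = T1 (p x), forall x, p (V2 x) = T2 (p x) &
            forall x, p (V1' x) = T1' (p x)],
        [/\ forall x, sqn (V1 x) = sqn x, forall x, sqn (V2 x) = sqn x &
            forall x, sqn (V1' x) = sqn x] &
        forall x, V1 (V2 x) = V2 (V1' x)].
Proof.
have [U [Udec UE]] := reflection_ex mirror_closed mirror0 mirror_linear.
have Ufix y : mirror y -> U y = y.
  move=> My; rewrite -[y in LHS]addr0 UE ?subr0// => m _; exact: dot0l.
have UJ h : U (J h) = J h by apply: Ufix; exact: mirror_J.
(* [defect12 h] is half the sum of a vector of the mirror and one orthogonal to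
   it. *)
have UA h : U (defect12 h) = defect21 h.
  have ABo m : mirror m -> '[defect12 h - defect21 h, m] = 0.
    by move=> Mm; apply: hdot_eq0C; exact: (Mm (0%N, h)).
  have := UE _ _ (mirror_defectD h) ABo.
  have add_sub (a b : K) : a + b + (a - b) = a + a.
    by rewrite addrACA subrr addr0.
  have sub_sub (a b : K) : a + b - (a - b) = b + b.
    by rewrite opprB addrC addrA subrK.
  rewrite add_sub sub_sub (linearD U) => h2.
  have two : (2 : R[i]) != 0 by rewrite pnatr_eq0.
  by apply: (scalerI two); rewrite !scaler_nat !mulr2n.
have Us x : U (s (s x)) = s (s (U x)).
  have [a [b [Ma bM ->]]] := Udec x.
  have sbM m : mirror m -> '[s (s b), m] = 0.
    by move=> Mm; rewrite !ss' bM//; exact: mirror_s'.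
  by rewrite UE// !(linearD s) (UE _ _ (mirror_s Ma) sbM) !(linearN s).
have UU x : U (U x) = x.
  have [a [b [Ma bM ->]]] := Udec x.
  by rewrite UE// UE ?opprK// => m Mm; rewrite dotNl bM ?oppr0.
have sqnU x : sqn (U x) = sqn x.
  have [a [b [Ma bM ->]]] := Udec x.
  have ab : '[a, b] = 0 by apply: hdot_eq0C; exact: bM.
  by rewrite UE// sqnBo// sqnDo.
have pU x : p (U x) = p x.
  have [a [b [Ma bM ->]]] := Udec x; rewrite UE//.
  have pb : p b = 0.
    apply: hdot_extl => h; rewrite dot0l; apply: hdot_eq0C; rewrite -Jp.
    by apply: hdot_eq0C; apply: bM; exact: mirror_J.
  by rewrite (linearB p) (linearD p) pb subr0 addr0.
pose d1 := e1 \o D1; pose d1' := e1 \o D1'; pose d2 := e3 \o D2.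
pose W1 := mk_linear (lift_linear T1 d1).
pose W1' := mk_linear (lift_linear T1' d1').
pose W2 := mk_linear (lift_linear T2 d2).
have pW1 x : p (W1 x) = T1 (p x) by apply: p_lift => h; exact: pe1.
have pW1' x : p (W1' x) = T1' (p x) by apply: p_lift => h; exact: pe1.
have pW2 x : p (W2 x) = T2 (p x) by apply: p_lift => h; exact: pe3.
have sqnW1 x : sqn (W1 x) = sqn x.
  by apply: sqn_lift => h /=; rewrite ?pe1 ?s'e1 ?sqn_e1.
have sqnW1' x : sqn (W1' x) = sqn x.
  by apply: sqn_lift => h /=; rewrite ?pe1 ?s'e1 ?sqn_e1.
have sqnW2 x : sqn (W2 x) = sqn x.
  by apply: sqn_lift => h /=; rewrite ?pe3 ?s'e3 ?sqn_e3.
have W1E y : W1 y = J (T1 (p y)) + e1 (D1 (p y)) + s (y - J (p y)) by [].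
have W1'E y : W1' y = J (T1' (p y)) + e1 (D1' (p y)) + s (y - J (p y)) by [].
have W2E y : W2 y = J (T2 (p y)) + e3 (D2 (p y)) + s (y - J (p y)) by [].
have W12 x : W1 (W2 x) =
    J (T1 (T2 (p x))) + defect12 (p x) + s (s (x - J (p x))).
  rewrite W1E pW2 (_ : W2 x - _ = e3 (D2 (p x)) + s (x - J (p x))).
    by rewrite (linearD s) /defect12 !addrA.
  by rewrite W2E [LHS]addrC !addrA addNr add0r.
have W21 x : W2 (W1' x) =
    J (T2 (T1' (p x))) + defect21 (p x) + s (s (x - J (p x))).
  rewrite W2E pW1' (_ : W1' x - _ = e1 (D1' (p x)) + s (x - J (p x))).
    by rewrite (linearD s) /defect21 !addrA.
  by rewrite W1'E [LHS]addrC !addrA addNr add0r.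
have UW x : U (W1 (W2 x)) = W2 (W1' (U x)).
  rewrite W12 W21 (linearD U (J _ + _)) (linearD U (J _)) UJ UA Us.
  by rewrite (linearB U) UJ pU T12.
exists (U \o W1), (W2 \o U), (U \o W1'); split; first split.
- by move=> x; rewrite /= pU pW1.
- by move=> x; rewrite /= pW2 pU.
- by move=> x; rewrite /= pU pW1'.
- by split=> x; rewrite /= ?sqnU ?sqnW1 ?sqnW2 ?sqnW1' ?sqnU.
by move=> x; rewrite /= UW !UU.
Qed.

End Intertwining.
End ShiftedDilation.

(** * The lifting theorem *)

Section Inclusion.
Context (R : realType) (H K : hilbertType R).
Variables (J : {linear H -> K}) (p : {linear K -> H}).
Hypothesis Jp : forall h y, '[J h, y] = '[h, p y].
Hypothesis pJ : forall h, p (J h) = h.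

(** The range of [J] is the common kernel of the functionals
    [x |-> <x, y - J p y>]. *)
Lemma coisometry_inclusion : hilbert_inclusion J.
Proof.
split=> [x y|]; first by rewrite Jp pJ.
have pJp y h : '[y, J h] = '[p y, h] by rewrite dotC Jp -dotC.
rewrite (_ : range J = [set x | forall y, '[x, y - J (p y)] = 0]).
  apply: (@closed_kernel _ _ _ (fun y x => '[x, y - J (p y)])).
    by move=> y x z; rewrite dotBl.
  move=> y; exists (2 * sqn (y - J (p y))).
    by rewrite mulr_ge0// sqn_ge0.
  by move=> x; rewrite mulrAC; exact: normsq_hdot_le.
apply/seteqP; split=> x /=.
  by move=> [h _ <-] y; rewrite Jp (linearB p) pJ subrr dot0r.
move=> xJ; exists (p x) => //; apply: hdot_extl => y.
by have /eqP := xJ y; rewrite dotBr pJp subr_eq0 => /eqP ->; rewrite Jp.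
Qed.

(** The condition [B^* J = J A^*] is [p B = A p] after taking adjoints, and the
    adjoints exist. *)
Lemma is_lift_of (A : 'B(H)) (B : 'B(K)) :
  (forall x, p (B x) = A (p x)) -> is_lift J A B.
Proof.
move=> pB; have [A' AA'] := adjoint_ex A; have [B' BB'] := adjoint_ex B.
have pJp y h : '[y, J h] = '[p y, h] by rewrite dotC Jp -dotC.
exists A', B'; split=> // h; apply: hdot_extl => z.
by rewrite dotC -BB' pJp pB AA' -pJp -dotC.
Qed.

Lemma is_isometric_lift_of (A : 'B(H)) (B : 'B(K)) :
  (forall x, p (B x) = A (p x)) -> (forall x, sqn (B x) = sqn x) ->
  is_isometric_lift J A B.
Proof.
move=> pB sB; split; first exact: is_lift_of.
by move=> x; exact: eq_norm_sqn.
Qed.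

End Inclusion.

Theorem theorem5p13 (R : realType) (H : hilbertType R) (T1 T2 Q : 'B(H))
    (hT1 : contractive T1) (hT2 : contractive T2)
    (hQT1 : contractive (Q \o T1))
    (hcomm : T1 \o T2 = T2 \o Q \o T1) :
  exists (K : hilbertType R) (J : {linear H -> K}) (V1 V2 Qbar V1Q : 'B(K)),
    hilbert_inclusion J /\
    is_isometric_lift J T1 V1 /\
    is_isometric_lift J T2 V2 /\
    is_lift J Q Qbar /\
    is_isometric_lift J (Q \o T1) (Qbar \o V1Q) /\
    V1 \o V2 = V2 \o Qbar \o V1Q.
Proof.
pose T1' : 'B(H) := Q \o T1.
have [D1 D1lin D1E] := defect_ex hT1.
have [D2 D2lin D2E] := defect_ex hT2.
have [D1' D1'lin D1'E] := defect_ex hQT1.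
pose K := l2 H; pose J := mk_linear (@single_linear R H).
have plin : linear (fun x : K => l2_val x 0%N) by [].
pose p := mk_linear plin.
have Jp h (y : K) : '[J h, y] = '[h, p y] by exact: single_adjoint.
have pJ h : p (J h) = h by [].
(* Index 0 carries [H]; [s] maps index [n] to [2 n], and the two remaining odd
   classes modulo 4 receive the defects. *)
have f2 : {homo muln 2 : m n / (m < n)%N} by move=> m n; lia.
have f1 : {homo (fun n => 4 * n + 1)%N : m n / (m < n)%N} by move=> m n; lia.
have f3 : {homo (fun n => 4 * n + 3)%N : m n / (m < n)%N} by move=> m n; lia.
pose s := mk_linear (@push_linear R H _ f2).
pose s' := mk_linear (@pull_linear R H _ f2).
pose e1 := mk_linear (@push_linear R H _ f1).
pose e1' := mk_linear (@pull_linear R H _ f1).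
pose e3 := mk_linear (@push_linear R H _ f3).
pose e3' := mk_linear (@pull_linear R H _ f3).
have ps x : p (s x) = p x by exact: (@pushE _ _ _ f2 x 0).
have T12 h : T1 (T2 h) = T2 (T1' h) by exact: (congr1 (@^~ h) hcomm).
have e13 x : e1' (e3 x) = 0 by apply: pull_push_disjoint => m n; apply/eqP; lia.
have s'e1 x : s' (e1 x) = 0 by apply: pull_push_disjoint => m n; apply/eqP; lia.
have s'e3 x : s' (e3 x) = 0 by apply: pull_push_disjoint => m n; apply/eqP; lia.
have pe1 x : p (e1 x) = 0 by apply: push_out => m; rewrite addn1.
have pe3 x : p (e3 x) = 0 by apply: push_out => m; rewrite addn3.
have [V1 [V2 [V1' [[pV1 pV2 pV1'] [sV1 sV2 sV1'] V12]]]] :=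
  @isometric_intertwining R H K J p s s' Jp pJ (push_adjoint f2) (pushK f2) ps
    K e1 e3 e1' e3' (push_adjoint f1) (push_adjoint f3) (pushK f1) (pushK f3)
    e13 pe1 pe3 s'e1 s'e3 T1 T1' T2
    (mk_linear D1lin) (mk_linear D1'lin) (mk_linear D2lin) T12 D1E D1'E D2E.
have Jb : sq_bounded J.
  by apply: sq_bounded_isom => h; rewrite /dsqn Jp pJ.
have pb : sq_bounded p.
  by exists 1 => // x; rewrite mul1r; exact: l2_coord_sqn_le.
have Vb (V : {linear K -> K}) : (forall x, sqn (V x) = sqn x) -> sq_bounded V.
  exact: sq_bounded_isom.
have block_b (S : {linear H -> H}) : sq_bounded S ->
    sq_bounded (fun x => J (S (p x))).
  by move=> Sb; apply: (sq_bounded_comp (f := J)) => //; exact: sq_bounded_comp.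
have block_lin (S : {linear H -> H}) : linear (fun x => J (S (p x))).
  by move=> a x y; rewrite (linearP p) (linearP S) (linearP J).
(* [Qbar] and [V1Q] modify the identity and [V1'] in the [H]-component only. *)
pose Qm : {linear H -> H} := mk_linear (linear_sub Q idfun).
pose Tm : {linear H -> H} := mk_linear (linear_sub T1 T1').
have Qlin : linear (fun x => x + J (Qm (p x))).
  by move=> a x y; rewrite block_lin scalerDr addrACA.
have Qb : sq_bounded (fun x => x + J (Qm (p x))).
  apply: sq_boundedD; first exact: sq_bounded_isom.
  apply: block_b; apply: sq_boundedB; first exact: op_sq_bounded.
  exact: sq_bounded_isom.
have Vlin : linear (fun x => V1' x + J (Tm (p x))).
  by move=> a x y; rewrite block_lin (linearP V1') scalerDr addrACA.
have VQb : sq_bounded (fun x => V1' x + J (Tm (p x))).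
  apply: sq_boundedD; first exact: sq_bounded_isom.
  by apply: block_b; apply: sq_boundedB; exact: op_sq_bounded.
pose Qbar := mk_op Qlin Qb; pose V1Q := mk_op Vlin VQb.
have QbarE x : Qbar x = x + J (Qm (p x)) by [].
have V1QE x : V1Q x = V1' x + J (Tm (p x)) by [].
have QmE h : Qm h = Q h - h by [].
have TmE h : Tm h = T1 h - T1' h by [].
have pV1Q x : p (V1Q x) = T1 (p x).
  by rewrite V1QE (linearD p) pJ pV1' TmE addrC subrK.
have QV x : Qbar (V1Q x) = V1' x.
  rewrite QbarE pV1Q V1QE -addrA -(linearD J) QmE TmE.
  by rewrite addrA subrK subrr linear0 addr0.
exists K, J, (mk_op (linearP V1) (Vb _ sV1)), (mk_op (linearP V2) (Vb _ sV2)),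
  Qbar, V1Q.
split; first exact: coisometry_inclusion Jp pJ.
split; first by apply: (is_isometric_lift_of Jp); [exact: pV1|exact: sV1].
split; first by apply: (is_isometric_lift_of Jp); [exact: pV2|exact: sV2].
split.
  apply: (is_lift_of Jp) => x.
  by rewrite QbarE (linearD p) pJ QmE addrC subrK.
split.
  by apply: (is_isometric_lift_of Jp) => x; rewrite [_ x]QV.
by apply/funext => x; have := V12 x; rewrite -(QV x).
Qed.
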